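(* Let $H=(h_{ji})$ be an $r\times n$ matrix with $h_{ji}\in\{0,1\}$ for all $j,i$, let $\mathcal K=\mathcal K(H)\subseteq\mathbb R^n$ be the fundamental cone of $H$, and let $C=\{\mathbf c\in\mathbb F_2^n : H\mathbf c^{\mathsf T}=\mathbf 0\}$ be the binary code with parity-check matrix $H$. Let $\mathbf p=(p_1,\dots,p_n)$ be a vector of integers. Then the following are equivalent: (1) $\mathbf p$ is an unscaled pseudo-codeword (of $C$ with respect to the Tanner graph $T(H)$). (2) $\mathbf p\in\mathcal K$ and $H\mathbf p^{\mathsf T}=\mathbf 0$ in $\mathbb F_2^r$. In other words, the unscaled pseudo-codewords are precisely those integer vectors in the fundamental cone which reduce modulo $2$ to codewords of $C$.
   Context: Fundamental cone: $\mathcal K(H)$ is the set of $\boldsymbol\nu=(\nu_1,\dots,\nu_n)\in\mathbb R^n$ such that for all $1\le i\le n$ and $1\le j\le r$: $\nu_i\ge 0$ and $\sum_{i'\ne i}h_{ji'}\nu_{i'}\ge h_{ji}\nu_i$ (computed over $\mathbb R$). Tanner graph: $T(H)$ is the bipartite graph with bit nodes $x_1,\dots,x_n$ and check nodes $f_1,\dots,f_r$, where $\{x_i,f_j\}$ is an edge iff $h_{ji}=1$. A Tanner graph determines a code: a binary assignment to the bit nodes is a codeword iff at each check node the sum mod $2$ of the values at its neighboring bit nodes is $0$. Covers: for a vertex $v$ let $\partial(v)$ be its set of neighbors. A cover of a graph $G=(V,E)$ is a graph $\widetilde G=(\widetilde V,\widetilde E)$ with a surjective graph homomorphism $\pi:\widetilde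 V\to V$ such that for each $v\in V$ and $\tilde v\in\pi^{-1}(v)$, $\partial(\tilde v)$ is mapped bijectively onto $\partial(v)$. It is an $M$-cover ($M\geq 1$ an integer) if $|\pi^{-1}(v)|=M$ for every $v\in V$. Graphs here are undirected and bipartite graphs have no multiple edges. An $M$-cover $\widetilde T$ of $T=T(H)$ is again a Tanner graph, with bit nodes $x_{(i,k)}$ and check nodes $f_{(j,l)}$ ($1\le k,l\le M$) lying over $x_i$ and $f_j$; it determines a code $\widetilde C\subseteq\mathbb F_2^{nM}$ whose coordinates are indexed by the pairs $(i,k)$. Unscaled pseudo-codeword: if $\tilde{\mathbf a}=(a_{(i,k)})$ is a codeword of the code $\widetilde C$ corresponding to some $M$-cover of $T$ (some $M\ge1$), the unscaled pseudo-codeword corresponding to $\tilde{\mathbf a}$ is $(p_1,\dots,p_n)$ where $p_i$ is the number of $k\in\{1,\dots,M\}$ with $a_{(i,k)}\neq 0$. An unscaled pseudo-codeword is any vector arising in this way. *)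

(* Defs.v *)
From HB Require Import structures.
From mathcomp Require Import all_boot all_order all_algebra.
From mathcomp Require Import reals.

Set Implicit Arguments.
Unset Strict Implicit.
Unset Printing Implicit Defensive.
Import Order.TTheory GRing.Theory Num.Theory.
Local Open Scope ring_scope.

(* Finite undirected graphs without multiple edges; only finite graphs can be
   M-covers of a finite graph. *)
Record graph := Graph {
  vertex :> finType;
  adj : rel vertex;
  adj_sym : symmetric adj }.

Definition neighbors (G : graph) (v : G) : {set G} := [set w | adj v w].

Record is_cover (Gt G : graph) (pi : Gt -> G) : Prop := IsCover {
  cover_surj : forall v : G, exists vt : Gt, pi vt = v;
  cover_hom : forall ut vt : Gt, adj ut vt -> adj (pi ut) (pi vt);
  cover_inj : forall vt : Gt, {in neighbors vt &, injective pi};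
  cover_img : forall vt : Gt, pi @: neighbors vt = neighbors (pi vt) }.

Record is_Mcover (M : nat) (Gt G : graph) (pi : Gt -> G) : Prop := IsMCover {
  Mcover_cover : is_cover pi;
  Mcover_card : forall v : G, #|[set vt : Gt | pi vt == v]| = M }.

(* A Tanner graph is a bipartite graph with a distinguished side of bit nodes;
   the vertices on the other side are the check nodes. *)
Record tanner := Tanner {
  tanner_graph :> graph;
  is_bit : pred tanner_graph;
  tanner_bipartite :
    forall u v : tanner_graph, adj u v -> is_bit u != is_bit v }.

Definition bit_node (T : tanner) : finType := {x : T | is_bit x}.

Definition tanner_code (T : tanner) : {set {ffun bit_node T -> 'F_2}} :=
  [set a : {ffun bit_node T -> 'F_2} |
    [forall f : T, ~~ is_bit f ==>
      (\sum_(x : bit_node T | val x \in neighbors f) a x == 0)]].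

Section TannerOfMatrix.
Variables (r n : nat) (H : 'M[int]_(r, n)).

Definition matrix_adj (u v : 'I_n + 'I_r) : bool :=
  match u, v with
  | inl i, inr j | inr j, inl i => H j i == 1
  | _, _ => false
  end.

Lemma matrix_adj_sym : symmetric matrix_adj.
Proof. by case=> [i|j] [i'|j']. Qed.

Definition matrix_graph : graph := Graph matrix_adj_sym.

Definition matrix_is_bit (u : matrix_graph) : bool :=
  if u is inl _ then true else false.

Lemma matrix_bipartite (u v : matrix_graph) :
  adj u v -> matrix_is_bit u != matrix_is_bit v.
Proof. by case: u v => [i|j] [i'|j']. Qed.

Definition tanner_of_matrix : tanner := Tanner matrix_bipartite.

Definition bit_vertex (i : 'I_n) : tanner_of_matrix := inl i.

End TannerOfMatrix.

(* A cover of a Tanner graph is again a Tanner graph, whose bit nodes are the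
   vertices lying over bit nodes. *)
Section CoverTanner.
Variables (T : tanner) (Gt : graph) (pi : Gt -> T) (cov : is_cover pi).

Lemma cover_bipartite (u v : Gt) :
  adj u v -> is_bit (pi u) != is_bit (pi v).
Proof. by move=> /(cover_hom cov) /tanner_bipartite. Qed.

Definition cover_tanner : tanner :=
  @Tanner Gt (fun v => is_bit (pi v)) cover_bipartite.

End CoverTanner.

(* The coordinates a_(i,k), 1 <= k <= M, of a codeword a of the cover are its
   values on the M bit nodes lying over x_i; the number of nonzero ones does
   not depend on how these nodes are numbered. *)
Definition unscaled_pseudocodeword (r n : nat) (H : 'M[int]_(r, n))
    (p : 'rV[int]_n) : Prop :=
  exists (M : nat) (Gt : graph) (pi : Gt -> tanner_of_matrix H)
         (cov : is_Mcover M pi),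
    (1 <= M)%N /\
    exists2 a : {ffun bit_node (cover_tanner (Mcover_cover cov)) -> 'F_2},
      a \in tanner_code (cover_tanner (Mcover_cover cov)) &
      forall i : 'I_n,
        p 0 i = #|[set x | (pi (val x) == bit_vertex H i) && (a x != 0)]|%:Z.

(* Nonnegativity is required separately from the inequalities indexed by the
   rows, so that it is not lost when H has no rows. *)
Definition fundamental_cone (R : realType) (r n : nat) (H : 'M[int]_(r, n))
    (nu : 'rV[R]_n) : Prop :=
  (forall i : 'I_n, 0 <= nu 0 i) /\
  (forall (i : 'I_n) (j : 'I_r),
     (H j i)%:~R * nu 0 i <= \sum_(i' < n | i' != i) (H j i')%:~R * nu 0 i').

Definition mod2 (m n : nat) (A : 'M[int]_(m, n)) : 'M['F_2]_(m, n) :=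
  map_mx intr A.

Definition binary_code (r n : nat) (H : 'M[int]_(r, n)) : {set 'rV['F_2]_n} :=
  [set c : 'rV['F_2]_n | mod2 H *m c^T == 0].

(* Main.v *)
(* Reading a codeword of a cover at the M checks over f_j, and projecting the
   neighborhoods, gives M even-weight 0/1 words on N(j); their sum is p
   restricted to N(j).  Each such word satisfies the cone inequalities and has
   even sum, hence so does p.

   Conversely, if p satisfies the conditions at f_j, then p restricted to N(j)
   is the degree sequence of a loopless multigraph, i.e. a sum of words of
   weight 2, which zero words pad to M words w_(j,1), ..., w_(j,M) for a common
   M.  Over each edge {x_i, f_j}, a permutation joining the first p_i copies of
   x_i to the copies f_(j,l) with i in the support of w_(j,l) yields an M-cover
   in which setting the first p_i copies of every x_i to 1 is a codeword. *)

Require Import Defs.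
From mathcomp Require Import all_boot all_order all_algebra.
From mathcomp Require Import reals.
From mathcomp Require Import perm zify.

Set Implicit Arguments.
Unset Strict Implicit.
Unset Printing Implicit Defensive.
Import Order.TTheory GRing.Theory Num.Theory.
Local Open Scope ring_scope.

(** * Combinatorics of finite sets, counts and parity *)

(* Greedy: the pair split off consists of the two largest entries, since a third
   entry equal to m.+1 would make the total exceed m.+1.*2. *)
Lemma sum_pairs_decomposition (I : finType) (m : nat) (q : I -> nat) :
    (\sum_i q i = m.*2)%N -> (forall i, q i <= m)%N ->
  exists s : seq {set I},
    [/\ size s = m, {in s, forall A : {set I}, #|A| = 2}
      & forall i, count (fun A : {set I} => i \in A) s = q i].
Proof.
elim: m q => [|m IHm] q sum_q le_q.
  by exists [::]; split=> // i /=; apply/esym/eqP; rewrite -leqn0.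
have [i0] : exists i, q i != 0%N.
  case: (pickP (fun i => q i != 0%N)) => [i|q0]; first by exists i.
  by move: sum_q; rewrite big1 // => i _; apply/eqP/negbFE/q0.
move=> _.
case: (arg_maxnP q (erefl : predT i0)) => a _ max_a.
have sum_a := sum_q; rewrite (bigD1 a) //= in sum_a.
(* A second nonzero entry exists: otherwise [q a] would be the whole total [m.+1.*2], exceeding the
   bound [m.+1]. *)
have [i1 i1a qi1] : exists2 i, i != a & (0 < q i)%N.
  case: (pickP (fun i => (i != a) && (0 < q i)%N)) => [i /andP[]|q0].
    by exists i.
  move: sum_a; rewrite big1; first by have := le_q a; lia.
  by move=> i ia; have := q0 i; rewrite ia; lia.
case: (@arg_maxnP _ i1 (fun i => i != a) q i1a) => b ba max_b.
have qb_gt0 : (0 < q b)%N by apply: leq_trans qi1 (max_b _ i1a).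
have qab : (q b <= q a)%N by apply: max_a.
rewrite (bigD1 b) //= in sum_a.
pose q' i := (q i - ((i == a) || (i == b)))%N.
have sum_q' : (\sum_i q' i = m.*2)%N.
  rewrite (bigD1 a) //= (bigD1 b) //= /q' !eqxx orbT.
  rewrite (eq_bigr q); first by lia.
  by move=> i /andP[/negPf-> /negPf->]; rewrite subn0.
have le_q' i : (q' i <= m)%N.
  rewrite /q'; have [->|ia] := eqVneq i a; first by have := le_q a; rewrite /=; lia.
  have [->|ib] := eqVneq i b; first by have := le_q b; rewrite /=; lia.
  have := max_b _ ia; have := le_q i.
  move: sum_a; rewrite (bigD1 i) /=; last by rewrite ia.
  by rewrite /=; lia.
have [s [sz_s pair_s count_s]] := IHm _ sum_q' le_q'.
exists ([set a; b] :: s); split; first by rewrite /= sz_s.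
- by move=> A; rewrite inE => /predU1P[->|/pair_s//]; rewrite cards2 eq_sym ba.
move=> i /=; rewrite count_s !inE /q'.
by have [->|_] := eqVneq i a; last have [->|_] := eqVneq i b; rewrite /=; lia.
Qed.

(** List [A] followed by its complement, and [B] followed by its complement; matching equal
    positions of the two lists gives the permutation. *)
Lemma perm_card_setP (T : finType) (A B : {set T}) :
  #|A| = #|B| -> exists s : {perm T}, forall x, (s x \in B) = (x \in A).
Proof.
move=> cardAB.
pose u (C : {set T}) := enum C ++ enum (~: C).
have memu C x : x \in u C by rewrite mem_cat !mem_enum inE orbN.
have uniq_u C : uniq (u C).
  rewrite cat_uniq !enum_uniq andbT /=; apply/hasPn => x.
  by rewrite !mem_enum inE.
have size_u C : size (u C) = #|T| by rewrite size_cat -!cardE cardsC.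
have lt_index C x : (index x (u C) < #|T|)%N by rewrite -(size_u C) index_mem.
pose f x := nth x (u B) (index x (u A)).
have f_inj : injective f.
  move=> x y; rewrite /f (set_nth_default x) ?size_u // => /eqP.
  rewrite nth_uniq ?size_u // => /eqP eq_xy.
  by rewrite -(nth_index x (memu A x)) eq_xy nth_index.
exists (perm f_inj) => x; rewrite permE /f nth_cat -cardE -cardAB.
rewrite index_cat mem_enum; case: (boolP (x \in A)) => xA; last first.
  rewrite cardE ltnNge leq_addr /= addKn.
  apply/negbTE; suff: nth x (enum (~: B)) (index x (enum (~: A))) \in enum (~: B).
    by rewrite mem_enum inE.
  rewrite mem_nth // -cardE; have := cardsC A; have := cardsC B.
  rewrite -cardAB => <- /addnI <-; rewrite cardE index_mem mem_enum inE.
  by rewrite xA.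
have lt_ix : (index x (enum A) < #|A|)%N by rewrite cardE index_mem mem_enum.
by rewrite lt_ix -mem_enum mem_nth // -cardE -cardAB.
Qed.

Lemma natr_F2_eq0 (k : nat) : ((k%:R : 'F_2) == 0) = ~~ odd k.
Proof. by rewrite -(dvdn_pcharf (pchar_Fp (erefl : prime 2))) dvdn2. Qed.

Lemma natr_F2_neq0 (x : 'F_2) : x = (x != 0 : nat)%:R.
Proof. by apply/val_inj; case: x => -[|[|]]. Qed.

(** If [c i] is 1, the remaining terms have odd sum, which is therefore positive. This is the cone
    inequality for a single even-weight word. *)
Lemma even_sum_leq (I : finType) (P : pred I) (c : I -> nat) (i : I) :
    P i -> (c i <= 1)%N -> ~~ odd (\sum_(i' | P i') c i') ->
  (c i <= \sum_(i' | P i' && (i' != i)) c i')%N.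
Proof. by move=> Pi; rewrite (bigD1 i) //=; lia. Qed.

Lemma card_sig_val (I : finType) (A P : pred I) :
  #|[set x : {x | A x} | P (val x)]| = #|[set x | A x && P x]|.
Proof.
by rewrite -!sum1dep_card (big_sub_cond A P (fun=> 1%N)).
Qed.

(** Positions past the end of [s] read the default [x0], which fails [P], so padding to length [M]
    adds nothing to the count. *)
Lemma card_nth_count (U : Type) (x0 : U) (P : pred U) (s : seq U) (M : nat) :
    ~~ P x0 -> (size s <= M)%N ->
  #|[set l : 'I_M | P (nth x0 s l)]| = count P s.
Proof.
move=> Px0 sM; rewrite -sum1dep_card.
rewrite -(big_mkord (fun l => P (nth x0 s l)) (fun=> 1%N)).
rewrite (big_cat_nat (leq0n _) sM) /=.
rewrite [X in (_ + X)%N]big_nat_cond [X in (_ + X)%N]big_pred0 ?addn0.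
  by rewrite -sum1_count [RHS](big_nth x0).
move=> l; apply/negbTE/negP => /andP[/andP[s_l _]].
by rewrite nth_default // (negPf Px0).
Qed.

Lemma pair_inj (U V : Type) (u : U) : injective (@pair U V u).
Proof. by move=> v v' []. Qed.

(** * Codewords of covers and the cone over the naturals *)

Section CoverWord.
Variables (r n : nat) (H : 'M[int]_(r, n)).
Let T := tanner_of_matrix H.

(* [A] encodes a binary word of the cover; its values on check nodes are
   irrelevant. *)
Definition cover_word (Gt : graph) (pi : Gt -> T) (A : pred Gt)
    (q : 'I_n -> nat) :=
  (forall f, ~~ is_bit (pi f) -> ~~ odd #|[set x in neighbors f | A x]|) /\
  (forall i, q i = #|[set x | (pi x == bit_vertex H i) && A x]|).

(** Trades words over the subtype of bit nodes for predicates on all vertices of the cover, and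
    vanishing sums in ['F_2] for even cardinalities. *)
Lemma unscaled_pseudocodewordP (p : 'rV[int]_n) :
  unscaled_pseudocodeword H p <->
  exists (M : nat) (Gt : graph) (pi : Gt -> T) (A : pred Gt) (q : 'I_n -> nat),
    [/\ is_Mcover M pi, (0 < M)%N, cover_word pi A q & forall i, p 0 i = q i].
Proof.
have code_card (M : nat) (Gt : graph) (pi : Gt -> T) (cov : is_Mcover M pi)
    (a : {ffun bit_node (cover_tanner (Mcover_cover cov)) -> 'F_2})
    (A : pred Gt) : (forall x, a x = (A (val x) : nat)%:R) ->
  (forall f, ~~ is_bit (pi f) ->
    (\sum_(x : bit_node (cover_tanner (Mcover_cover cov))
             | val x \in neighbors f) a x == 0)
    = ~~ odd #|[set x in neighbors f | A x]|) /\
  (forall i, #|[set x | (pi (val x) == bit_vertex H i) && (a x != 0)]|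
    = #|[set x | (pi x == bit_vertex H i) && A x]|).
  move=> aA; split=> [f f_check|i].
    under eq_bigr do rewrite aA.
    rewrite -natr_sum natr_F2_eq0; congr (~~ odd _).
    rewrite -big_mkcondr sum1dep_card.
    pose P (x : Gt) := (x \in neighbors f) && A x.
    rewrite (card_sig_val (fun x : Gt => is_bit (pi x)) P).
    apply: eq_card => x; rewrite /P !inE /=.
    (* Neighbors of a check are bit nodes by bipartiteness, so restricting to the subtype loses none
       of them. *)
    apply: andb_idl => /andP[/(cover_hom (Mcover_cover cov))].
    by move=> /tanner_bipartite; rewrite (negPf f_check) /=; case: (matrix_is_bit (pi x)).
  pose P (x : Gt) := (pi x == bit_vertex H i) && A x.
  transitivity #|[set x : {x : Gt | is_bit (pi x)} | P (val x)]|.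
    by apply: eq_card => x; rewrite !inE aA /P; case: (A _).
  rewrite card_sig_val; apply: eq_card => x; rewrite /P !inE /=.
  by apply: andb_idl => /andP[/eqP->].
split.
  case=> M [Gt [pi [cov [M_gt0 [a a_code p_a]]]]].
  pose A (x : Gt) := if insub x is Some u then a u != 0 else false.
  have aA x : a x = (A (val x) : nat)%:R by rewrite /A valK -natr_F2_neq0.
  have [code_a card_a] := code_card _ _ _ cov a A aA.
  exists M, Gt, pi, A, (fun i => #|[set x | (pi x == bit_vertex H i) && A x]|).
  split=> // [|i]; last by rewrite p_a card_a.
  split=> // f f_check; rewrite -code_a //.
  by move: a_code; rewrite inE => /forall_inP; apply.
case=> M [Gt [pi [A [q [cov M_gt0 [A_even q_A] pq]]]]].
pose a : {ffun bit_node (cover_tanner (Mcover_cover cov)) -> 'F_2} :=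
  [ffun x => (A (val x) : nat)%:R].
have aA x : a x = (A (val x) : nat)%:R by rewrite ffunE.
have [code_a card_a] := code_card _ _ _ cov a A aA.
exists M, Gt, pi, cov; split=> //; exists a => [|i]; last first.
  by rewrite pq q_A card_a.
by rewrite inE; apply/forall_inP => f f_check; rewrite code_a ?A_even.
Qed.

(** Condition (2) for natural vectors, row by row. Cone inequalities with [H j i = 0] have left side
    0, so only those with [i] in N(j) are kept. *)
Definition nat_cone (q : 'I_n -> nat) :=
  forall j, ~~ odd (\sum_(i | H j i == 1%R) q i) /\
    forall i, H j i == 1 ->
      (q i <= \sum_(i' | (H j i' == 1%R) && (i' != i)) q i')%N.

Lemma cover_word_cone (M : nat) (Gt : graph) (pi : Gt -> T) (A : pred Gt)
    (q : 'I_n -> nat) :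
  is_cover pi -> cover_word pi A q -> nat_cone q.
Proof.
move=> cov [A_even q_A] j.
(* For [f] over the check [j], [c f] is the word read at [f], projected to the coordinates of the
   base graph. *)
pose N f i := [set x in neighbors f | (pi x == bit_vertex H i) && A x].
pose c f i := #|N f i|.
pose over_j := [pred f : Gt | pi f == inr j].
(* Each copy of the bit [i] has exactly one neighbor over the check [j], so summing over these
   checks counts every 1-valued copy once. *)
have q_sum i : H j i == 1 -> q i = (\sum_(f in over_j) c f i)%N.
  move=> Hji; rewrite q_A -sum1dep_card.
  under [RHS]eq_bigr do rewrite /c -sum1dep_card.
  rewrite (exchange_big_dep (fun x => (pi x == bit_vertex H i) && A x)) /=.
    apply: eq_bigr => x /andP[/eqP pix Ax].
    have : inr j \in neighbors (pi x) by rewrite pix inE.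
    rewrite -(cover_img cov) => /imsetP[f fx pif].
    rewrite (big_pred1 f) // => g; rewrite !inE pix eqxx Ax !andbT adj_sym.
    apply/andP/eqP => [[/eqP pig xg]|->]; last first.
      by rewrite inE in fx; rewrite -pif eqxx.
    by apply: (cover_inj cov _ fx); rewrite ?inE // pig.
  by move=> f x _ /andP[].
have c_le1 f i : (c f i <= 1)%N.
  apply/card_le1_eqP => x y; rewrite !inE.
  move=> /and3P[xf /eqP pix _] /and3P[yf /eqP piy _].
  by apply: (cover_inj cov (vt := f)); rewrite ?inE // pix piy.
have c_even f : f \in over_j -> ~~ odd (\sum_(i | H j i == 1%R) c f i).
  rewrite inE => /eqP pif.
  suff -> : (\sum_(i | H j i == 1%R) c f i)%N =
      #|[set x in neighbors f | A x]| by rewrite A_even ?pif.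
  rewrite -sum1dep_card.
  under eq_bigr do rewrite /c -sum1dep_card.
  rewrite (exchange_big_dep (fun x => (x \in neighbors f) && A x)) /=.
    apply: eq_bigr => x /andP[xf Ax].
    have := cover_hom cov (_ : adj f x); rewrite inE in xf => /(_ xf).
    rewrite pif; case pix: (pi x) => [i|//] /= Hji.
    rewrite (big_pred1 i) // => i'; rewrite !inE xf Ax !andbT /=.
    by apply/andP/eqP => [[_ /eqP[->]]|->].
  by move=> i x _ /and3P[-> _ ->].
split=> [|i Hji].
  rewrite (eq_bigr _ q_sum) exchange_big /=.
  apply: (big_ind (fun k => ~~ odd k)) => // x y.
  by rewrite oddD => /negPf-> /negPf->.
rewrite q_sum //.
have -> : (\sum_(i' | (H j i' == 1%R) && (i' != i)) q i' =
    \sum_(i' | (H j i' == 1%R) && (i' != i)) \sum_(f in over_j) c f i')%N.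
  by apply: eq_bigr => i' /andP[Hji' _]; apply: q_sum.
rewrite exchange_big /=; apply: leq_sum => f fj.
exact: (@even_sum_leq _ (fun i => H j i == 1)) (c_even _ fj).
Qed.

Lemma nat_cone_check_words (q : 'I_n -> nat) (M : nat) (j : 'I_r) :
    nat_cone q -> (\sum_i q i <= M)%N ->
  exists w : 'I_M -> {set 'I_n}, (forall l, ~~ odd #|w l|) /\
    forall i, #|[set l | i \in w l]| = if H j i == 1 then q i else 0%N.
Proof.
move=> /(_ j)[q_even q_le] sum_q.
pose qj i := if H j i == 1 then q i else 0%N.
(* The number of weight-2 words needed. The cone inequality at [i] says exactly that [q i] is at
   most half of the row total. *)
pose m := (\sum_(i | H j i == 1%R) q i)./2.
have sum_qj : (\sum_i qj i = m.*2)%N.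
  by rewrite -big_mkcond /= even_halfK.
have le_qj i : (qj i <= m)%N.
  rewrite /qj; case: ifP => // Hji; have := q_le _ Hji.
  move: q_even; rewrite /m (bigD1 i) //=; lia.
have [s [sz_s pair_s count_s]] := sum_pairs_decomposition sum_qj le_qj.
(* The default [set0] supplies the zero words beyond the pairs. *)
exists (fun l => nth set0 s l); split=> [l|i].
  have [l_s|s_l] := ltnP l (size s); last by rewrite nth_default ?cards0.
  by rewrite pair_s ?mem_nth.
rewrite (@card_nth_count _ _ (fun A : {set 'I_n} => i \in A)) ?inE ?count_s //.
rewrite sz_s; apply: leq_trans sum_q; apply: leq_trans (_ : m.*2 <= _)%N.
  by rewrite -addnn leq_addr.
by rewrite -sum_qj leq_sum // => i' _; rewrite /qj; case: ifP.
Qed.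

(** * The cover given by one permutation of the sheets per edge *)

Section PermutationCover.
Variables (M : nat) (sigma : 'I_n -> 'I_r -> {perm 'I_M}).

Definition perm_cover_adj (u v : T * 'I_M) : bool :=
  match u, v with
  | (inl i, k), (inr j, l) | (inr j, l), (inl i, k) =>
    (H j i == 1) && (sigma i j k == l)
  | _, _ => false
  end.

Lemma perm_cover_adj_sym : symmetric perm_cover_adj.
Proof. by move=> [[i|j] k] [[i'|j'] l]. Qed.

Definition perm_cover : graph := Graph perm_cover_adj_sym.
Definition perm_cover_proj (u : perm_cover) : T := u.1.

Lemma perm_cover_is_Mcover : (0 < M)%N -> is_Mcover M perm_cover_proj.
Proof.
move=> M_gt0; split; last first.
  move=> v; rewrite -[RHS]card_ord -(card_imset predT (@pair_inj _ _ v)).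
  apply: eq_card => -[u k]; rewrite !inE /perm_cover_proj /=.
  by apply/eqP/imsetP => [->|[k' _ [->]]] //; exists k.
split.
- by move=> v; exists (v, Ordinal M_gt0).
- by move=> [[i|j] k] [[i'|j'] l] //= /andP[].
- move=> [[i|j] k] [[i1|j1] l1] [[i2|j2] l2]; rewrite !inE //=.
    by move=> /andP[_ /eqP<-] /andP[_ /eqP<-] [->].
  move=> /andP[_ /eqP<-] /andP[_ /eqP+] [i12].
  by rewrite i12 => /perm_inj->.
move=> [[i|j] k]; apply/setP => v; rewrite inE; apply/imsetP/idP => [[[u l]]|].
- by rewrite inE /= => uv ->; move: uv; case: u => [i'|j'] //= /andP[].
- case: v => [i'|j'] //= Hji; exists (inr j', sigma i j' k) => //.
  by rewrite inE /= Hji eqxx.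
- by rewrite inE /= => uv ->; move: uv; case: u => [i'|j'] //= /andP[].
case: v => [i'|j'] //= Hji; exists (inl i', (sigma i' j)^-1%g k) => //.
by rewrite inE /= Hji permKV eqxx.
Qed.

End PermutationCover.

Lemma nat_cone_cover_word (q : 'I_n -> nat) : nat_cone q ->
  exists (M : nat) (Gt : graph) (pi : Gt -> T) (A : pred Gt),
    [/\ is_Mcover M pi, (0 < M)%N & cover_word pi A q].
Proof.
(* This [M] bounds every [q i] and serves all checks at once; the successor keeps it positive when
   [q] is zero. *)
move=> q_cone; pose M := (\sum_i q i).+1.
have q_lt i : (q i <= M)%N by rewrite leqW // (bigD1 i) //= leq_addr.
have [w w_spec] := fin_all_exists (fun j =>
  nat_cone_check_words j q_cone (leqnSn _ : (_ <= M)%N)).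
pose first i := [set k : 'I_M | (k < q i)%N].
have card_first i : #|first i| = q i.
  transitivity #|[set k : 'I_M | nth false (nseq (q i) true) k]|.
    by apply: eq_card => k; rewrite !inE nth_nseq; case: ltnP.
  by rewrite (@card_nth_count _ _ id) ?size_nseq // count_nseq mul1n.
have sigma_ex i j : exists s : {perm 'I_M},
    H j i == 1 -> forall k, (i \in w j (s k)) = (k < q i)%N.
  (* Without an edge between [i] and [j] the permutation is irrelevant, and the identity fills the
     slot. *)
  case: (boolP (H j i == 1)) => [Hji|_]; last by exists 1%g.
  have [|s s_spec] := @perm_card_setP _ (first i) [set l | i \in w j l].
    by rewrite card_first (w_spec j).2 Hji.
  by exists s => _ k; have := s_spec k; rewrite !inE.
have [sigma sigma_spec] := fin_all_exists (fun i => fin_all_exists (sigma_ex i)).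
pose A (u : perm_cover sigma) := if u.1 is inl i then (u.2 < q i)%N else false.
exists M, (perm_cover sigma), (@perm_cover_proj _ sigma), A.
split; [exact: perm_cover_is_Mcover | by [] | split].
  move=> [[i|j] l] // _.
  (* [lift i] is the only copy of the bit [i] that can be adjacent to the check [(j, l)]; the
     1-valued neighbors of that check are thus the lifts of the even set [w j l]. *)
  pose lift i : perm_cover sigma := (inl i, (sigma i j)^-1%g l).
  rewrite (_ : [set x in _ | _] = lift @: w j l).
    by rewrite card_imset ?(w_spec j).1 // => i i' [].
  apply/setP => -[[i|j'] k]; rewrite !inE /A /=; last first.
    by apply/esym/imsetP => -[].
  apply/andP/imsetP => [[/andP[Hji /eqP sigma_k] k_q]|[i' i'w [-> ->]]].
    exists i; last by rewrite /lift -sigma_k permK.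
    by rewrite -sigma_k sigma_spec.
  have Hji : H j i' == 1.
    have := (w_spec j).2 i'; case: ifP => // _ /eqP.
    by rewrite cards_eq0 => /eqP/setP/(_ l); rewrite !inE i'w.
  by rewrite Hji permKV eqxx -(sigma_spec _ _ Hji) permKV.
move=> i; rewrite -[LHS]card_first -(card_imset _ (@pair_inj _ _ (inl i : T))).
apply: eq_card => -[v k]; rewrite !inE /perm_cover_proj /A /=.
apply/imsetP/andP => [[k' k'_q [-> ->]]|[/eqP-> k_q]].
  by rewrite inE in k'_q.
by exists k; rewrite ?inE.
Qed.

(** Stated over a general ring so as to serve both the real cone inequalities and the parity checks
    in ['F_2]. *)
Lemma natr_row_sum (V : pzRingType) (hH : forall j i, H j i = 0 \/ H j i = 1)
    (p : 'rV[int]_n) (q : 'I_n -> nat) (j : 'I_r) (P : pred 'I_n) :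
    (forall i, p 0 i = q i) ->
  \sum_(i | P i) (H j i)%:~R * ((map_mx intr p : 'rV[V]_n) 0 i) =
    (\sum_(i | P i && (H j i == 1%R)) q i)%N%:R.
Proof.
move=> pq; rewrite natr_sum big_mkcondr; apply: eq_bigr => i _.
by rewrite mxE pq; case: (hH j i) => ->; rewrite ?mul0r ?mul1r.
Qed.

Lemma nat_coneP (R : realType) (hH : forall j i, H j i = 0 \/ H j i = 1)
    (p : 'rV[int]_n) (q : 'I_n -> nat) : (forall i, p 0 i = q i) ->
  fundamental_cone H (map_mx intr p : 'rV[R]_n) /\
    mod2 H *m (mod2 p)^T = 0 <-> nat_cone q.
Proof.
move=> pq.
have mod2E j : (mod2 H *m (mod2 p)^T) j 0 =
    (\sum_(i | H j i == 1%R) q i)%N%:R.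
  rewrite -(natr_row_sum 'F_2 hH j xpredT pq) mxE.
  by apply: eq_bigr => i _; rewrite !mxE.
split=> [[[_ p_le] Hp] j|q_cone].
  split=> [|i Hji]; first by rewrite -natr_F2_eq0 -mod2E Hp mxE.
  have := p_le i j; rewrite (natr_row_sum R hH _ _ pq) mxE pq (eqP Hji) mul1r.
  by rewrite -pmulrn ler_nat; under eq_bigl do rewrite andbC.
split; [split=> [i|i j] | apply/matrixP => j k].
- by rewrite mxE pq -pmulrn ler0n.
- rewrite (natr_row_sum R hH _ _ pq) mxE pq.
  have [->|Hji] := hH j i; first by rewrite mul0r ler0n.
  rewrite Hji mul1r -pmulrn ler_nat; under eq_bigl do rewrite andbC.
  by apply: (q_cone j).2; rewrite Hji.
by rewrite ord1 mod2E mxE; apply/eqP; rewrite natr_F2_eq0; apply: (q_cone j).1.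
Qed.

End CoverWord.

Theorem theorem4p4 (R : realType) (r n : nat) (H : 'M[int]_(r, n))
    (hH : forall (j : 'I_r) (i : 'I_n), H j i = 0 \/ H j i = 1)
    (p : 'rV[int]_n) :
  (unscaled_pseudocodeword H p <->
     fundamental_cone H (map_mx intr p : 'rV[R]_n) /\
     mod2 H *m (mod2 p)^T = 0) /\
  (unscaled_pseudocodeword H p <->
     fundamental_cone H (map_mx intr p : 'rV[R]_n) /\
     mod2 p \in binary_code H).
Proof.
suff main : unscaled_pseudocodeword H p <->
    fundamental_cone H (map_mx intr p : 'rV[R]_n) /\ mod2 H *m (mod2 p)^T = 0.
  by split=> //; rewrite main inE; split=> -[cone /eqP Hp]; split=> //; apply/eqP.
rewrite unscaled_pseudocodewordP; split.
  case=> M [Gt [pi [A [q [cov _ A_q pq]]]]].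
  apply/(nat_coneP R hH pq); exact: cover_word_cone (Mcover_cover cov) A_q.
move=> p_cone.
(* Absolute values change nothing here, since the cone makes [p] nonnegative. *)
pose q i := absz (p 0 i).
have pq i : p 0 i = q i.
  by have := p_cone.1.1 i; rewrite mxE ler0z /q => /gez0_abs->.
have [M [Gt [pi [A [cov M_gt0 A_q]]]]] :=
  nat_cone_cover_word ((nat_coneP R hH pq).1 p_cone).
by exists M, Gt, pi, A, q.
Qed.
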